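(* In the Chung–Lu random graph model, assume $S_2>S$, let $s\neq t$ be vertices and $r\ge1$ an integer with $2r<S_2/S$. Then $$E[NBP_r(s,t)]\le \frac{p_{st}\,(S_2/S)^{r-1}}{1-\frac{S}{S_2}}\exp\!\left(\frac{\left(2r\frac{S}{S_2}\right)^2p_{\max}}{1-\frac{2rS}{S_2}}\right).$$
   Context: Chung–Lu model: given $d_1,\dots,d_n>0$ with $S=\sum_i d_i$ and $\max_i d_i^2\le S$, each edge $\{i,j\}$ (including loops) of the random undirected graph on $\{1,\dots,n\}$ is present independently with probability $p_{ij}=d_id_j/S$. $S_2=\sum_i d_i^2$, $d_{\max}=\max_i d_i$, $p_{\max}=d_{\max}^2/S$. $NBP_r(s,t)$ is the number of nonbacktracking walks of length $r$ from $s$ to $t$: sequences $(x_1,\dots,x_{r+1})$ with $x_1=s$, $x_{r+1}=t$, every $\{x_i,x_{i+1}\}$ an edge of the graph, and $x_i\neq x_{i+2}$ for $1\le i\le r-1$. *)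

(* Defs.v *)
From HB Require Import structures.
From mathcomp Require Import all_boot.
From Stdlib Require Import Reals.

Set Implicit Arguments.
Unset Strict Implicit.
Unset Printing Implicit Defensive.

Section ChungLu.
Variable n : nat.
Variable d : 'I_n -> R.

Definition CL_S : R := \big[Rplus/0%R]_(i < n) d i.
Definition CL_S2 : R := \big[Rplus/0%R]_(i < n) (d i * d i)%R.
Definition CL_dmax : R := \big[Rmax/0%R]_(i < n) d i.
Definition CL_pmax : R := (CL_dmax * CL_dmax / CL_S)%R.
Definition CL_p (i j : 'I_n) : R := (d i * d j / CL_S)%R.

(* Unordered pairs {i,j} (loops included) represented as (i,j) with i <= j *)
Definition edge := {e : 'I_n * 'I_n | (e.1 <= e.2)%N}.
Definition graph := {ffun edge -> bool}.

Definition CL_prob (G : graph) : R :=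
  \big[Rmult/1%R]_(e : edge)
     (if G e then CL_p (val e).1 (val e).2 else (1 - CL_p (val e).1 (val e).2)%R).

Definition adj (G : graph) (i j : 'I_n) : bool :=
  [exists e : edge, G e && ((val e == (i, j)) || (val e == (j, i)))].

Definition NBP (G : graph) (r : nat) (s t : 'I_n) : nat :=
  #|[set x : {ffun 'I_r.+1 -> 'I_n} |
      [&& x ord0 == s, x ord_max == t,
          [forall i : 'I_r, adj G (x (inord i)) (x (inord i.+1))] &
          [forall i : 'I_r.-1, x (inord i) != x (inord i.+2)]]]|.

Definition E_NBP (r : nat) (s t : 'I_n) : R :=
  \big[Rplus/0%R]_(G : graph) (CL_prob G * INR (NBP G r s t))%R.

End ChungLu.

(* Main.v *)
(** The expected number of nonbacktracking walks is the sum, over the walks, of the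
    product of the probabilities of their distinct edges.  Encode a walk by
    recording, for each step along an edge already used, an earlier step along that edge
    and the relative orientation; a step along a new edge gets the empty label.
    The code forces the vertices at both ends of every old step to equal
    earlier ones (strictly earlier, by nonbacktracking), so a walk is determined by
    its code and its vertices at the remaining free times.  Write [a = S_2 / S] and
    [q = 1 / a].  Summing [d^2] over each free vertex and bounding every other
    weight by [d_max], a code with [k] passages from a new step to an old one and
    [l] old steps contributes at most [p_st a^(r-1) (p_max q)^k q^l].  Each old
    step has at most [2r] labels, so with [z = 2rq] a transfer recursion along the code
    bounds the sum of [(p_max q)^k q^l] by [(1 + p_max q z / (1 - z))^r], which is
    at most [exp (p_max z^2 / (2 (1 - z)))]. *)

Require Import Defs.
From HB Require Import structures.
From mathcomp Require Import all_boot all_order all_algebra.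
From mathcomp Require ring lra zify.

Set Implicit Arguments.
Unset Strict Implicit.
Unset Printing Implicit Defensive.
Import Order.TTheory GRing.Theory Num.Theory.

(** * Patterns of new and old steps *)

Section Patterns.

(* [true] stands for a new step.  The default [true] of [nth] pads the pattern
   with a new step, so that a pattern ending in a new step has no turn at its end. *)
Definition turns (b : bitseq) : nat :=
  \sum_(i < size b) (nth true b i && ~~ nth true b i.+1).

(** For [true :: new_steps c] this is the number of free times, those whose neighbouring steps are
    both new. *)
Definition straights (b : bitseq) : nat :=
  \sum_(i < size b) (nth true b i && nth true b i.+1).

Lemma straights_turns b : straights b + turns b = count id b.
Proof.
rewrite -sum1_count big_mkcond (big_nth true) big_mkord -big_split /=.
by apply: eq_bigr => i _; case: (nth _ _ _); case: (nth _ _ _).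
Qed.

Lemma turns_cons p a b : turns [:: p, a & b] = (p && ~~ a) + turns (a :: b).
Proof. by rewrite {1}/turns big_ord_recl. Qed.

Lemma turns_seq1 p : turns [:: p] = 0.
Proof. by rewrite /turns big_ord_recl big_ord0 /= andbF. Qed.

End Patterns.

(** * Transfer recursion for the total weight of codes *)

Section Transfer.
Import mathcomp.algebra_tactics.ring mathcomp.algebra_tactics.lra.
Local Open Scope ring_scope.
Variables (K : realFieldType) (r : nat).
Local Notation label := (option ('I_r * bool)).

Definition is_new (a : label) : bool := a == None.

(** [p] tells whether the step before the code is new. A turn costs [y], later taken as [p_max q],
    and an old step costs [q]. *)
Definition code_weight (y q : K) p (c : seq label) : K :=
  y ^+ turns (p :: map is_new c) * q ^+ count (predC is_new) c.

Lemma sum_labels (F : label -> K) G :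
  (forall l, F (Some l) = G) -> \sum_a F a = F None + (2 * r%:R) * G.
Proof.
move=> FG; rewrite (bigD1 None) //=; congr (_ + _).
rewrite (reindex_omap Some id) /=; last by case.
rewrite (eq_bigl predT); last by move=> l; rewrite eqxx.
rewrite (eq_bigr (fun _ => G)) // sumr_const card_prod card_bool card_ord.
by rewrite -[G *+ _]mulr_natl natrM; ring.
Qed.

Lemma sum_tuple_cons (T : finType) n (F : n.+1.-tuple T -> K) :
  \sum_c F c = \sum_a \sum_(c : n.-tuple T) F [tuple of a :: c].
Proof.
rewrite pair_big (reindex (fun p : T * n.-tuple T => [tuple of p.1 :: p.2])) //=.
exists (fun c => (thead c, [tuple of behead c])) => [[a c] _ | c _] /=.
  by rewrite theadE; congr (_, _); apply: val_inj.
by rewrite [RHS]tuple_eta.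
Qed.

Lemma sum_code_weight (y q : K) n :
  0 <= y -> 0 <= q -> 2 * r%:R * q < 1 ->
  \sum_(c : n.-tuple label) code_weight y q true c
    <= (1 + y * (2 * r%:R * q) / (1 - 2 * r%:R * q)) ^+ n.
Proof.
move=> y0 q0; set z := 2 * r%:R * q => z1.
have z0 : 0 <= z by rewrite /z !mulr_ge0.
set l := (1 - z)^-1; have l0 : 0 <= l by rewrite invr_ge0 subr_ge0 ltW.
have lz : 1 + z * l = l by rewrite /l; field; lra.
rewrite -[_ / _]/(y * z * l); set e := 1 + y * z * l.
have e1 : 1 <= e by rewrite /e lerDl !mulr_ge0.
pose A p m : K := \sum_(c : m.-tuple label) code_weight y q p c.
have A0 p : A p 0%N = 1.
  rewrite /A (big_pred1 [tuple]) => [|c]; last by apply/esym/eqP; rewrite (tuple0 c).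
  by rewrite /code_weight /= turns_seq1 !expr0 mulr1.
(* Split off the first label: an old one costs [q], and also [y] if the step before it is new. *)
have AS p m : A p m.+1 = A true m + (2 * r%:R) * (q * (if p then y else 1) * A false m).
  rewrite /A sum_tuple_cons (sum_labels (G := q * (if p then y else 1) * A false m)) //.
    congr (_ + _); apply: eq_bigr => c _.
    by rewrite /code_weight /= turns_cons andbF.
  move=> a; rewrite mulr_sumr; apply: eq_bigr => c _.
  rewrite /code_weight /= turns_cons andbT exprD exprS.
  by case: p; rewrite ?expr1 ?expr0; ring.
(* The transfer matrix of [A] maps [(1, l)] to [(e, l)], which is at most [e (1, l)]. *)
suff [] : A true n <= e ^+ n /\ A false n <= l * e ^+ n by [].
elim: n => [|m [IHt IHf]]; first by rewrite !A0 expr0 mulr1; split=> //; nra.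
rewrite !AS.
have -> : (2 * r%:R) * (q * y * A false m) = y * z * A false m by rewrite /z; ring.
have -> : (2 * r%:R) * (q * 1 * A false m) = z * A false m by rewrite /z; ring.
have Hf : z * A false m <= z * (l * e ^+ m) by rewrite ler_wpM2l.
have Hf' : y * z * A false m <= y * z * (l * e ^+ m) by rewrite ler_wpM2l ?mulr_ge0.
have em : 0 <= e ^+ m by rewrite exprn_ge0 //; lra.
have le : 0 <= l * e ^+ m by rewrite mulr_ge0.
split; rewrite exprS.
  by apply: (le_trans (lerD IHt Hf')); rewrite /e; lra.
apply: (le_trans (lerD IHt Hf)).
have -> : e ^+ m + z * (l * e ^+ m) = l * e ^+ m by rewrite -{2}lz; ring.
by rewrite mulrCA ler_peMl.
Qed.

End Transfer.

(** * Codes as pointers to earlier times *)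

Section Pointers.
Variable r : nat.
Local Notation label := (option ('I_r * bool)).

Definition label_src (l : 'I_r * bool) : nat := if l.2 then val l.1 else l.1.+1.
Definition label_tgt (l : 'I_r * bool) : nat := if l.2 then l.1.+1 else val l.1.

(** Both ends of an old step then point strictly back: time [k] below [k], and time [k.+1] to at
    most [k]. *)
Definition valid_code (c : seq label) :=
  forall k l, nth None c k = Some l -> label_src l < k /\ label_tgt l <= k.

Definition follows (V : Type) (c : seq label) (X : nat -> V) :=
  forall k l, nth None c k = Some l ->
    X k = X (label_src l) /\ X k.+1 = X (label_tgt l).

(* The fixed points of [parent] are the free times.  Time [size c] is one of them when
   the last step is new, because [nth] then defaults to [None]. *)
Definition parent (c : seq label) (i : nat) : nat :=
  if i is k.+1 then
    if nth None c k is Some l then label_tgt l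
    else if nth None c i is Some l then label_src l else i
  else 0.

Definition new_steps (c : seq label) : bitseq := map (@is_new r) c.

Lemma nth_new_steps c k : nth true (new_steps c) k = is_new (nth None c k).
Proof.
have [lt|le] := ltnP k (size c); first exact: nth_map.
by rewrite !nth_default ?size_map.
Qed.

Lemma valid_code0 c : valid_code c -> nth None c 0 = None.
Proof. by move=> vc; case E: (nth None c 0) => [l|//]; have [] := vc _ _ E. Qed.

Lemma parent_lt c i : valid_code c -> parent c i != i -> parent c i < i.
Proof.
move=> vc; case: i => //= k; case E: (nth None c k) => [l|].
  by have [_] := vc _ _ E; rewrite ltnS.
case E': (nth None c k.+1) => [l|]; last by rewrite eqxx.
by have [] := vc _ _ E'.
Qed.

(** The two entries are the steps into and out of time [i], and an old one points strictly back. The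
    prepended [true] acts as a new step into time [0]. *)
Lemma parent_fixed c i : valid_code c ->
  (parent c i == i) =
  nth true (true :: new_steps c) i && nth true (true :: new_steps c) i.+1.
Proof.
move=> vc; case: i => [|k] /=; rewrite !nth_new_steps.
  by rewrite valid_code0.
case E: (nth None c k) => [l|] /=.
  by have [_ le] := vc _ _ E; apply/negbTE; rewrite neq_ltn ltnS le.
case E': (nth None c k.+1) => [l|] /=; last by rewrite eqxx.
by have [lt _] := vc _ _ E'; apply/negbTE; rewrite neq_ltn lt.
Qed.

Lemma follows_parent (V : Type) c (X : nat -> V) i :
  follows c X -> X (parent c i) = X i.
Proof.
move=> fX; case: i => //= k; case E: (nth None c k) => [l|].
  by have [_ ->] := fX _ _ E.
by case E': (nth None c k.+1) => [l|//]; have [-> _] := fX _ _ E'.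
Qed.

(** Iterating [parent] decreases strictly until a free time is reached, and a sequence following the
    code keeps its vertex along the way. *)
Lemma parent_root c i : valid_code c ->
  exists j, [/\ j <= i, parent c j = j, parent c i = i -> j = i &
    forall (V : Type) (X : nat -> V), follows c X -> X j = X i].
Proof.
move=> vc; elim/ltn_ind: i => i IH.
have [fi|nfi] := eqVneq (parent c i) i; first by exists i.
have [j [le fj _ Xj]] := IH _ (parent_lt vc nfi).
exists j; split=> //; first exact: leq_trans le (ltnW (parent_lt vc nfi)).
  by move=> E; rewrite E eqxx in nfi.
by move=> V X fX; rewrite (Xj _ _ fX) (follows_parent _ fX).
Qed.

End Pointers.

(** * Summing over the walks with a given code *)

Section CodeClass.
Import mathcomp.zify.zify.
Local Open Scope ring_scope.
Variables (K : realFieldType) (V : finType) (r : nat).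
Local Notation label := (option ('I_r * bool)).

Definition trace (x : {ffun 'I_r.+1 -> V}) (i : nat) : V := x (inord i).

Lemma trace_ord (x : {ffun 'I_r.+1 -> V}) (i : 'I_r.+1) : trace x i = x i.
Proof. by rewrite /trace inord_val. Qed.

(** Regroup by time: [delta i] occurs once for a new step into [i] and once for a new step out of
    it. *)
Lemma prod_steps (delta : nat -> K) (b : bitseq) : size b = r ->
  \prod_(k < r | nth true b k) (delta k * delta k.+1) =
  \prod_(i < r.+1) delta i ^+
     ((0 < i)%N && nth true (true :: b) i + ((i < r)%N && nth true b i)).
Proof.
move=> sb; under [RHS]eq_bigr do rewrite exprD.
rewrite big_mkcond.
rewrite (eq_bigr (fun k : 'I_r => delta k ^+ nth true b k * delta k.+1 ^+ nth true b k)).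
  2: by move=> k _; case: (nth true b k); rewrite ?expr1 ?expr0 ?mulr1.
rewrite !big_split /= mulrC; congr (_ * _).
  by rewrite big_ord_recl /= expr0 mul1r; apply: eq_bigr => i _.
rewrite big_ord_recr /= ltnn expr0 mulr1; apply: eq_bigr => i _.
by rewrite ltn_ord.
Qed.

(** Resetting the coordinates outside [F] to a fixed [v0] is injective on [P], and the sum over all
    functions frozen there factors over coordinates. *)
Lemma sum_restrict (P : {set {ffun 'I_r.+1 -> V}}) (F : {set 'I_r.+1}) (g : V -> K) :
  (forall v, 0 <= g v) ->
  (forall x y, x \in P -> y \in P -> {in F, x =1 y} -> x = y) ->
  \sum_(x in P) \prod_(i in F) g (x i) <= (\sum_v g v) ^+ #|F|.
Proof.
move=> g0 inj; have [->|[x0 x0P]] := set_0Vmem P.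
  by rewrite big_set0 exprn_ge0 // sumr_ge0.
pose v0 := x0 ord0.
pose phi (x : {ffun 'I_r.+1 -> V}) := [ffun i => if i \in F then x i else v0].
pose G i v := if i \in F then g v else (v == v0)%:R.
have G0 i v : 0 <= G i v by rewrite /G; case: ifP.
have sG i : \sum_v G i v = if i \in F then \sum_v g v else 1.
  rewrite /G; case: ifP => // _; rewrite (bigD1 v0) //= eqxx big1 ?addr0 //.
  by move=> v /negbTE ->.
have -> : (\sum_v g v) ^+ #|F| = \prod_i \sum_v G i v.
  by rewrite -prodr_const big_mkcond; apply: eq_bigr => i _; rewrite sG.
rewrite bigA_distr_bigA /=.
have phiI : {in P &, injective phi}.
  move=> x y xP yP E; apply: inj => // i iF.
  by move/ffunP/(_ i): E; rewrite !ffunE iF.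
rewrite (eq_bigr (fun x => \prod_i G i (phi x i))); last first.
  move=> x _; rewrite [LHS]big_mkcond; apply: eq_bigr => i _.
  by rewrite /G ffunE; case: ifP; rewrite ?eqxx.
rewrite -(big_imset (fun f : {ffun _} => \prod_i G i (f i)) phiI) /= [leLHS]big_mkcond.
by apply: ler_sum => f _; case: ifP => // _; apply: prodr_ge0.
Qed.

(* Every vertex weight is at most [1], so only the weights at time [0], at the
   time [tau] at which [t] is forced, and at the remaining free times are kept. *)
Lemma class_bound (delta : V -> K) (s t : V) (c : r.-tuple label)
    (P : {set {ffun 'I_r.+1 -> V}}) x0 :
  (forall v, 0 <= delta v <= 1) -> s != t -> valid_code c -> x0 \in P ->
  (forall x, x \in P -> [/\ x ord0 = s, x ord_max = t & follows c (trace x)]) ->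
  exists f, (f.+1 + turns (true :: new_steps c) = count id (new_steps c))%N /\
  \sum_(x in P) \prod_(k < r | nth true (new_steps c) k)
      (delta (trace x k) * delta (trace x k.+1))
    <= delta s * delta t * (\sum_v delta v ^+ 2) ^+ f.
Proof.
move=> d01 st vc x0P HP; pose b := new_steps c.
have sb : size b = r by rewrite size_map size_tuple.
have d0 v : 0 <= delta v by case/andP: (d01 v).
have tr0 x : trace x 0 = x ord0 by rewrite -[0%N]/(val (@ord0 r)) trace_ord.
have trr x : trace x r = x ord_max by rewrite -{1}[r]/(val (@ord_max r)) trace_ord.
(* [tau0] is the free time to which the final time [r] leads, so every walk in [P] is at [t]
   then. *)
have [tau0 [let0 ftau fixr Xtau]] := parent_root r vc.
pose tau : 'I_r.+1 := Ordinal (let0 : (tau0 < r.+1)%N).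
pose fx (i : 'I_r.+1) := parent c i == i.
have xtau x : x \in P -> x tau = t.
  by move=> /HP[_ <- fX]; rewrite -trace_ord Xtau // trr.
have tau_neq0 : tau != ord0.
  apply/eqP => E; move: (xtau _ x0P); rewrite E; have [-> _ _] := HP _ x0P.
  by move/eqP; rewrite (negbTE st).
pose F := [set i : 'I_r.+1 | fx i & i \notin [:: ord0; tau]].
(* The free times are [0], [tau] and those in [F]. *)
have cardF : #|F|.+2 = straights (true :: b).
  rewrite /straights /= sb.
  have -> : (\sum_(i < r.+1) (nth true (true :: b) i && nth true (true :: b) i.+1) =
             \sum_(i < r.+1) fx i)%N.
    by apply: eq_bigr => i _; rewrite /fx parent_fixed.
  rewrite (bigD1 ord0) //= (bigD1 tau) //= /fx /= ftau !eqxx !add1n -sum1_card.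
  congr _.+2; rewrite big_mkcond [RHS]big_mkcond; apply: eq_bigr => i _.
  by rewrite !inE /fx; case: eqP; case: eqP; case: eqP.
exists #|F|; split.
  by have := straights_turns (true :: b); rewrite -cardF /= -/b; lia.
have inj x y : x \in P -> y \in P -> {in F, x =1 y} -> x = y.
  move=> xP yP E; apply/ffunP => i.
  have [sx _ fX] := HP _ xP; have [sy _ fY] := HP _ yP.
  have [j [lej fj _ Xj]] := parent_root i vc.
  rewrite -!trace_ord -(Xj _ _ fX) -(Xj _ _ fY).
  have jr : (j < r.+1)%N by apply: leq_ltn_trans lej _.
  rewrite -[j]/(val (Ordinal jr)) !trace_ord.
  have [->|j0] := eqVneq (Ordinal jr) ord0; first by rewrite sx sy.
  have [->|jt] := eqVneq (Ordinal jr) tau; first by rewrite !xtau.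
  by apply: E; rewrite !inE /fx /= fj eqxx negb_or j0 jt.
apply: (@le_trans _ _ (\sum_(x in P) delta s * delta t * \prod_(i in F) delta (x i) ^+ 2)).
  apply: ler_sum => x xP; have [xs _ _] := HP _ xP.
  rewrite (prod_steps (fun i => delta (trace x i)) sb).
  rewrite (bigD1 ord0) //= (bigD1 tau) //= mulrA.
  have r0 : (0 < r)%N.
    rewrite lt0n; apply/eqP => r0; move: st; rewrite -xs -(xtau _ xP).
    rewrite -!trace_ord (_ : val tau = 0%N) ?eqxx //=.
    by apply/eqP; rewrite -leqn0 -r0.
  have fixed (i : 'I_r.+1) : fx i -> nth true (true :: b) i /\ nth true b i.
    by rewrite /fx parent_fixed // => /andP[].
  have dX v (k m : nat) : (m <= k)%N -> delta v ^+ k <= delta v ^+ m.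
    by have /andP[? ?] := d01 v; apply: ler_wiXn2l.
  apply: ler_pM; rewrite ?prodr_ge0 ?mulr_ge0 ?exprn_ge0 //.
  - by move=> i _; rewrite exprn_ge0.
  - apply: ler_pM; rewrite ?exprn_ge0 // ?tr0 ?xs.
      by rewrite -[leRHS]expr1 dX // r0 nth_new_steps valid_code0.
    rewrite -{1}[tau0]/(val tau) trace_ord xtau // -[leRHS]expr1 dX //.
    have [|-> _] := fixed tau; first by rewrite /fx /= ftau.
    by have -> : (0 < tau0)%N by rewrite lt0n; exact: tau_neq0.
  rewrite [leRHS]big_mkcond [leLHS]big_mkcond; apply: ler_prod => i _.
  rewrite trace_ord !inE negb_or; have /andP[di0 di1] := d01 (x i).
  case: ifP => [/andP[i0 it]|_]; last by rewrite andbF ler01 lexx.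
  rewrite andbT exprn_ge0 //=; case: ifP => [fi|_].
    2: by rewrite -[1](expr0 (delta (x i))) dX.
  apply: dX; have [-> ->] := fixed _ fi.
  have -> : (0 < i)%N by rewrite lt0n.
  (* If [r] were free it would be its own root [tau]; hence [i] lies below [r] and has the full
     exponent [2]. *)
  suff -> : (i < r)%N by [].
  rewrite ltn_neqAle -ltnS ltn_ord andbT.
  apply: contra it => /eqP ir; apply/eqP/val_inj; rewrite /= ir fixr //.
  by move/eqP: fi; rewrite ir.
by rewrite -mulr_sumr ler_wpM2l ?mulr_ge0 // sum_restrict // => v; rewrite exprn_ge0.
Qed.

End CodeClass.

(** * Coding nonbacktracking walks *)

Section WalkCodes.
Import mathcomp.algebra_tactics.ring mathcomp.zify.zify.
Local Open Scope ring_scope.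
Variables (K : realFieldType) (V E : finType) (r : nat) (em : V -> V -> E).
Hypothesis em_inj : forall u v u' v',
  em u v = em u' v' -> (u = u' /\ v = v') \/ (u = v' /\ v = u').
Local Notation label := (option ('I_r * bool)).
Local Notation walk := {ffun 'I_r.+1 -> V}.

Definition step_edge (x : walk) k : E := em (trace x k) (trace x k.+1).

Definition walk_edges (x : walk) : {set E} := [set step_edge x k | k : 'I_r].

Definition nonbacktracking (x : walk) : bool :=
  [forall i : 'I_r.-1, trace x i != trace x i.+2].

(* The Boolean tells whether step [k] runs along step [j] in the same direction. *)
Definition walk_label (x : walk) (k : 'I_r) : label :=
  omap (fun j : 'I_r =>
          (j, (trace x j == trace x k) && (trace x j.+1 == trace x k.+1)))
    [pick j : 'I_r | (j < k)%N && (step_edge x j == step_edge x k)].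

Definition walk_code (x : walk) : r.-tuple label := [tuple walk_label x k | k < r].

Lemma nth_walk_code x (k : 'I_r) : nth None (walk_code x) k = walk_label x k.
Proof. by rewrite -tnth_nth tnth_mktuple. Qed.

Lemma walk_codeP x k l : nth None (walk_code x) k = Some l ->
  [/\ (l.1 < k < r)%N, trace x k = trace x (label_src l)
    & trace x k.+1 = trace x (label_tgt l)].
Proof.
have [kr|rk] := ltnP k r; last by rewrite nth_default ?size_tuple.
rewrite (nth_walk_code x (Ordinal kr)) /walk_label.
case: pickP => //= j /andP[jk /eqP/em_inj E1] [<-] /=.
rewrite /label_src /label_tgt /= (jk : (j < k)%N).
case: ifP => [/andP[/eqP-> /eqP->] //|nE].
by case: E1 => [[E1 E2]|[-> ->] //]; rewrite E1 E2 !eqxx in nE.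
Qed.

Lemma walk_code_follows x : follows (walk_code x) (trace x).
Proof. by move=> k l /walk_codeP[_ -> ->]. Qed.

(** The bound on the source could fail only if step [k] reversed step [k - 1], which is a
    backtrack. *)
Lemma walk_code_valid x : nonbacktracking x -> valid_code (walk_code x).
Proof.
move=> /forallP nb k l /walk_codeP[/andP[lk kr] Es Et].
rewrite /label_src /label_tgt in Es Et *; case: (l.2) in Es Et *; first by [].
split; last by rewrite ltnW.
rewrite ltn_neqAle lk andbT; apply/eqP => lk1.
have lr : (val l.1 < r.-1)%N by rewrite -ltnS prednK ?lk1 //; lia.
by have := nb (Ordinal lr); rewrite /= lk1 Et eqxx.
Qed.

(** New steps are the first traversals of edges, so they correspond bijectively to the distinct
    edges. *)
Lemma prod_walk_edges (p : E -> K) x :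
  \prod_(e in walk_edges x) p e =
  \prod_(k < r | nth true (new_steps (walk_code x)) k) p (step_edge x k).
Proof.
have newP (k : 'I_r) :
  reflect (forall j : 'I_r, step_edge x j = step_edge x k -> (k <= j)%N)
    (nth true (new_steps (walk_code x)) k).
  rewrite nth_new_steps nth_walk_code /walk_label.
  case: pickP => [j /andP[jk /eqP E1]|none] /=; constructor.
    by move/(_ j E1); rewrite leqNgt jk.
  by move=> j E1; rewrite leqNgt; have := none j; rewrite E1 eqxx andbT => ->.
pose N := [set k : 'I_r | nth true (new_steps (walk_code x)) k].
have -> : walk_edges x = (fun k : 'I_r => step_edge x k) @: N.
  apply/setP => e; apply/imsetP/imsetP => [[k _ ->]|[k _ ->]]; last by exists k.
  pose same (j : 'I_r) := step_edge x j == step_edge x k.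
  have [j /eqP E1 jmin] := @arg_minnP _ k same val (eqxx _).
  exists j => //; rewrite inE; apply/newP => i E2; apply: jmin.
  by rewrite /same E2 E1.
rewrite big_imset /=; first by apply: eq_bigl => k; rewrite inE.
move=> j k; rewrite !inE => /newP jN /newP kN E1; apply/val_inj/eqP.
by rewrite eqn_leq jN // kN.
Qed.

Lemma sum_walks_bound (d : V -> K) (S S2 D : K) (p : E -> K) (s t : V) :
  (forall v, 0 < d v <= D) -> 0 < S -> S2 = \sum_v d v ^+ 2 -> s != t -> (0 < r)%N ->
  (forall u v, p (em u v) = d u * d v / S) ->
  2 * r%:R * (S / S2) < 1 ->
  \sum_(x : walk | [&& x ord0 == s, x ord_max == t & nonbacktracking x])
      \prod_(e in walk_edges x) p e
  <= d s * d t / S * (S2 / S) ^+ r.-1 *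
     (1 + (D ^+ 2 / S) * (S / S2) * (2 * r%:R * (S / S2))
          / (1 - 2 * r%:R * (S / S2))) ^+ r.
Proof.
move=> dD S0 S2E st r0 pE z1.
have d0 v : 0 < d v by case/andP: (dD v).
have D0 : 0 < D by case/andP: (dD s) => ? ?; apply: lt_le_trans (d0 s) _.
have S20 : 0 < S2.
  rewrite S2E (bigD1 s) //= ltr_wpDr ?exprn_gt0 // sumr_ge0 // => v _.
  by rewrite exprn_ge0 // ltW.
set q := S / S2; have q0 : 0 < q by rewrite divr_gt0.
set y := D ^+ 2 / S * q; have y0 : 0 <= y by rewrite !mulr_ge0 ?exprn_ge0 ?invr_ge0 ?ltW.
set a := S2 / S; have a0 : 0 < a by rewrite divr_gt0.
(* Scaling by [D] puts the vertex weights in [[0, 1]]; each new step then releases a factor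
   [D ^+ 2 / S]. *)
pose delta v := d v / D.
rewrite (partition_big walk_code predT) //=.
set B := d s * d t / S * a ^+ r.-1.
have B0 : 0 <= B by rewrite !mulr_ge0 ?exprn_ge0 ?invr_ge0 ?ltW.
apply: (@le_trans _ _ (\sum_(c : r.-tuple label) B * code_weight y q true c)); last first.
  by rewrite -mulr_sumr ler_wpM2l // sum_code_weight // ltW.
apply: ler_sum => c _.
pose P := [set x : walk |
  [&& x ord0 == s, x ord_max == t & nonbacktracking x] && (walk_code x == c)].
have inP x : x \in P ->
    [/\ x ord0 = s, x ord_max = t, nonbacktracking x & walk_code x = c].
  by rewrite inE => /andP[/and3P[/eqP ? /eqP ? ?] /eqP ?].
rewrite (eq_bigl [in P]) => [|x]; last by rewrite inE.
have [->|[x0 x0P]] := set_0Vmem P.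
  by rewrite big_set0 mulr_ge0 // mulr_ge0 // exprn_ge0 // ltW.
have vc : valid_code c by have [_ _ nb <-] := inP _ x0P; apply: walk_code_valid.
have d01 v : 0 <= delta v <= 1.
  apply/andP; split; first by rewrite divr_ge0 // ltW.
  by rewrite ler_pdivrMr // mul1r; have /andP[] := dD v.
have Pf x : x \in P -> [/\ x ord0 = s, x ord_max = t & follows c (trace x)].
  by move=> /inP[-> -> _ <-]; split=> //; apply: walk_code_follows.
have [f [mE le]] := class_bound d01 st vc x0P Pf.
pose m := count id (new_steps c); rewrite -/m in mE.
rewrite (eq_bigr (fun x => (D ^+ 2 / S) ^+ m * \prod_(k < r | nth true (new_steps c) k)
      (delta (trace x k) * delta (trace x k.+1)))); last first.
  move=> x /inP[_ _ _ xc]; rewrite prod_walk_edges xc.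
  have -> : (D ^+ 2 / S) ^+ m = \prod_(k < r | nth true (new_steps c) k) (D ^+ 2 / S).
    rewrite /m -sum1_count (big_nth true) big_mkord size_map size_tuple.
    by rewrite -prodrXr; apply: eq_bigr => k _; rewrite expr1.
  rewrite -big_split; apply: eq_bigr => k _ /=; rewrite pE /delta; field.
  by rewrite !gt_eqF.
rewrite -mulr_sumr.
apply: (le_trans (ler_wpM2l _ le)); first by rewrite exprn_ge0 // divr_ge0 ?exprn_ge0 ?ltW.
rewrite le_eqVlt; apply/orP; left; apply/eqP; rewrite /code_weight -/(new_steps c) /B.
(* The [r] steps are the [m = f + 1 + turns] new ones and the old ones; this balances the powers of
   [a]. *)
have rE : (r.-1 = f + turns (true :: new_steps c) + count (predC (@is_new r)) c)%N.
  have := count_predC (@is_new r) c; rewrite size_tuple.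
  have -> : count (@is_new r) c = m by rewrite /m count_map.
  by lia.
rewrite rE -mE; set n1 := turns _; set n2 := count _ _.
have -> : \sum_v delta v ^+ 2 = S2 / D ^+ 2.
  by rewrite S2E mulr_suml; apply: eq_bigr => v _; rewrite expr_div_n.
have -> : S2 / D ^+ 2 = a / (D ^+ 2 / S) by rewrite /a; field; rewrite !gt_eqF.
have -> : y = (D ^+ 2 / S) / a by rewrite /y /q /a; field; rewrite !gt_eqF.
have -> : q = a^-1 by rewrite /q /a invf_div.
set pm := D ^+ 2 / S; have pm0 : pm != 0 by rewrite gt_eqF // divr_gt0 ?exprn_gt0.
have -> : delta s * delta t = d s * d t / S / pm.
  by rewrite /delta /pm; field; rewrite !gt_eqF.
clearbody pm a.
rewrite addSn exprS !exprD !expr_div_n !exprVn.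
have := (expf_neq0 f pm0, expf_neq0 n1 pm0).
have an0 n : a ^+ n != 0 by rewrite expf_neq0 // gt_eqF.
move: (an0 f) (an0 n1) (an0 n2).
move: (pm ^+ f) (pm ^+ n1) (a ^+ f) (a ^+ n1) (a ^+ n2) => p1 p2 a1 a2 a3 ? ? ? [? ?].
by field; apply/and5P; split=> //; rewrite gt_eqF.
Qed.

End WalkCodes.

(** * Random edge sets *)

Section RandomSubset.
Local Open Scope ring_scope.

(** Expand a product of two-term sums: an edge in [A] contributes only [p e], any other one
    [p e + (1 - p e) = 1]. *)
Lemma sum_subset_prob (K : comPzRingType) (E : finType) (p : E -> K) (A : {set E}) :
  \sum_(G : {ffun E -> bool})
     (\prod_e (if G e then p e else 1 - p e)) * [forall e in A, G e]%:R =
  \prod_(e in A) p e.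
Proof.
pose h e b := if b then p e else (e \notin A)%:R * (1 - p e).
transitivity (\prod_e \sum_b h e b); last first.
  rewrite [RHS]big_mkcond; apply: eq_bigr => e _; rewrite big_bool /h.
  by case: ifP => _ /=; rewrite ?mul0r ?addr0 // mul1r addrC subrK.
rewrite bigA_distr_bigA; apply: eq_bigr => G _.
have [/forall_inP GA|/forall_inPn[e eA Ge]] := boolP [forall e in A, G e].
  rewrite mulr1; apply: eq_bigr => e _; rewrite /h; case: ifP => // Ge.
  by case: (boolP (e \in A)) => [/GA|_]; rewrite ?Ge ?mul1r.
by rewrite mulr0 (bigD1 e) //= /h (negbTE Ge) eA mul0r mul0r.
Qed.

End RandomSubset.

From Stdlib Require Import Reals Lra.
From mathcomp Require Import Rstruct.

(** * Specialisation to the Chung-Lu graph *)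

Section ChungLuWalks.
Import mathcomp.zify.zify.
Variable n : nat.

Fact edge_of_subproof (u v : 'I_n) :
  let e := if u <= v then (u, v) else (v, u) in e.1 <= e.2.
Proof. by case: (leqP u v) => // /ltnW. Qed.

Definition edge_of (u v : 'I_n) : edge n :=
  exist (fun e : 'I_n * 'I_n => is_true (e.1 <= e.2))
    (if u <= v then (u, v) else (v, u)) (edge_of_subproof u v).

Lemma edge_of_inj u v u' v' : edge_of u v = edge_of u' v' ->
  (u = u' /\ v = v') \/ (u = v' /\ v = u').
Proof.
move/(congr1 val) => /=.
by case: ifP => _; case: ifP => _ [-> ->]; auto.
Qed.

Lemma edge_ofP (u v : 'I_n) (e : edge n) :
  (val e == (u, v)) || (val e == (v, u)) = (e == edge_of u v).
Proof.
rewrite -val_eqE /=; case: e => [[a b] /= ab].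
by case: (leqP u v) => uv; rewrite !xpair_eqE -!(inj_eq val_inj) /=; lia.
Qed.

Lemma adjE (G : graph n) u v : adj G u v = G (edge_of u v).
Proof.
apply/existsP/idP => [[e]|Ge]; first by rewrite edge_ofP => /andP[Ge /eqP<-].
by exists (edge_of u v); rewrite edge_ofP eqxx Ge.
Qed.

Local Open Scope ring_scope.
Variable d : 'I_n -> R.

Lemma CL_p_edge_of u v : CL_p d (val (edge_of u v)).1 (val (edge_of u v)).2 = CL_p d u v.
Proof. by rewrite /=; case: ifP => // _; rewrite /CL_p /= Rmult_comm. Qed.

Lemma le_CL_dmax v : Rle (d v) (CL_dmax d).
Proof.
rewrite /CL_dmax; have := mem_index_enum v; elim: index_enum => // w l IH.
rewrite inE big_cons => /orP[/eqP->|/IH le]; first exact: Rmax_l.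
by apply: Rle_trans le _; exact: Rmax_r.
Qed.

(** Linearity of expectation: a sequence is a walk of [G] exactly when all its edges lie in [G]. *)
Lemma E_NBP_sum r s t : E_NBP d r s t =
  \sum_(x : {ffun 'I_r.+1 -> 'I_n} |
         [&& x ord0 == s, x ord_max == t & nonbacktracking x])
      \prod_(e in walk_edges edge_of x) CL_p d (val e).1 (val e).2.
Proof.
pose good (x : {ffun 'I_r.+1 -> 'I_n}) :=
  [&& x ord0 == s, x ord_max == t & nonbacktracking x].
pose p (e : edge n) : R := CL_p d (val e).1 (val e).2.
transitivity (\sum_(G : graph n) \sum_(x | good x)
   (\prod_e (if G e then p e else 1 - p e)) * [forall e in walk_edges edge_of x, G e]%:R).
  apply: eq_bigr => G _; rewrite -big_distrr /= INRE; congr (_ * _).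
  rewrite /NBP -sum1_card natr_sum [RHS]big_mkcond [LHS]big_mkcond; apply: eq_bigr => x _.
  rewrite inE /good /nonbacktracking.
  have -> : [forall e in walk_edges edge_of x, G e] =
      [forall i : 'I_r, adj G (x (inord i)) (x (inord i.+1))].
    apply/forall_inP/forallP => [H i|H _ /imsetP[i _ ->]]; last by have := H i; rewrite adjE.
    by rewrite adjE; apply: H; apply/imsetP; exists i.
  rewrite /trace; do 2 (case: (_ == _) => //=); rewrite andbC.
  by do 2 case: [forall _, _].
by rewrite exchange_big; apply: eq_bigr => x _; apply: sum_subset_prob.
Qed.

Hypothesis d0 : forall i, 0 < d i.

Lemma CL_S_gt0 (s : 'I_n) : 0 < CL_S d.
Proof.
by rewrite /CL_S (bigD1 s) //= ltr_wpDr // sumr_ge0 // => i _; apply: ltW.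
Qed.

Lemma E_NBP_le r (s t : 'I_n) : s != t -> (0 < r)%nat ->
  2 * r%:R * (CL_S d / CL_S2 d) < 1 ->
  E_NBP d r s t <= CL_p d s t * (CL_S2 d / CL_S d) ^+ r.-1 *
    (1 + CL_pmax d * (CL_S d / CL_S2 d) * (2 * r%:R * (CL_S d / CL_S2 d))
         / (1 - 2 * r%:R * (CL_S d / CL_S2 d))) ^+ r.
Proof.
move=> st r0 z1; rewrite E_NBP_sum /CL_pmax RdivE RmultE -expr2 [CL_p d s t]RdivE RmultE.
apply: (sum_walks_bound edge_of_inj) => //.
- by move=> v; rewrite d0; apply/RleP/le_CL_dmax.
- exact: CL_S_gt0 s.
- by move=> u v; rewrite CL_p_edge_of.
Qed.

End ChungLuWalks.

(** * From powers to the exponential bound *)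

Lemma exp_mul_INR (c : R) (m : nat) : (exp (INR m * c) = exp c ^ m)%R.
Proof.
elim: m => [|m IH]; first by rewrite Rmult_0_l exp_0.
by rewrite S_INR Rmult_plus_distr_r Rmult_1_l exp_plus IH /= Rmult_comm.
Qed.

Lemma pow_le_exp (c : R) (m : nat) : (0 <= c -> (1 + c) ^ m <= exp (INR m * c))%R.
Proof.
move=> c0; rewrite exp_mul_INR; apply: pow_incr.
split; first lra.
exact: exp_ineq1_le.
Qed.

Theorem theorem3 (n : nat) (d : 'I_n -> R)
  (hpos : forall i, (0 < d i)%R)
  (hmax : forall i, (d i * d i <= CL_S d)%R)
  (hS2 : (CL_S d < CL_S2 d)%R)
  (s t : 'I_n) (hst : s <> t)
  (r : nat) (hr : (1 <= r)%N)
  (hr2 : (2 * INR r < CL_S2 d / CL_S d)%R) :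
  (E_NBP d r s t <=
     CL_p d s t * (CL_S2 d / CL_S d) ^ (r - 1) / (1 - CL_S d / CL_S2 d)
     * exp ((2 * INR r * (CL_S d / CL_S2 d)) ^ 2 * CL_pmax d
            / (1 - 2 * INR r * CL_S d / CL_S2 d)))%R.
Proof.
have S0 : (0 < CL_S d)%R by apply/RltP/(CL_S_gt0 _ s) => i; apply/RltP.
set S := CL_S d in hmax hS2 hr2 S0 *; set S2 := CL_S2 d in hS2 hr2 *.
set D := CL_dmax d.
have r0 : (0 < INR r)%R by apply: lt_0_INR; apply/ssrnat.ltP.
have S20 : (0 < S2)%R by lra.
set q := (S / S2)%R.
have q0 : (0 < q)%R by apply: Rdiv_lt_0_compat.
have q1 : (q < 1)%R.
  apply: (Rmult_lt_reg_r S2) => //.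
  by rewrite /q /Rdiv Rmult_assoc Rinv_l; lra.
have z1 : (2 * INR r * q < 1)%R.
  (* The claim is [hr2] multiplied by [q]. *)
  have -> : (1 = S2 / S * q)%R by rewrite /q; field; lra.
  exact: Rmult_lt_compat_r.
pose z := (2 * INR r * q)%R.
pose y := (D * D / S * q)%R.
have D0 : (0 < D)%R by apply: Rlt_le_trans (hpos s) (le_CL_dmax d s).
have y0 : (0 <= y)%R.
  by apply/Rmult_le_pos/Rlt_le/q0/Rlt_le/Rdiv_lt_0_compat => //; apply: Rmult_lt_0_compat.
pose c := (y * z / (1 - z))%R.
have main : (E_NBP d r s t <= CL_p d s t * (S2 / S) ^ (r - 1) * (1 + c) ^ r)%R.
  rewrite subn1 !RpowE; apply/RleP.
  have -> : c = (CL_pmax d * q * z / (1 - z))%R by [].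
  rewrite /z (INRE r).
  apply: E_NBP_le => //.
  - by move=> i; apply/RltP.
  - exact/eqP.
  - by apply/RltP; rewrite -(INRE r); exact: z1.
have c0 : (0 <= c)%R.
  apply: Rmult_le_pos; last by apply/Rlt_le/Rinv_0_lt_compat; rewrite /z; lra.
  by apply: Rmult_le_pos => //; apply: Rlt_le; rewrite /z; nra.
apply: Rle_trans main _.
set B := (CL_p d s t * (S2 / S) ^ (r - 1))%R.
have B0 : (0 <= B)%R.
  apply: Rmult_le_pos; last by apply: pow_le; apply/Rlt_le/Rdiv_lt_0_compat.
  by apply/Rlt_le/Rdiv_lt_0_compat => //; apply: Rmult_lt_0_compat.
apply: Rmult_le_compat => //; first by apply: pow_le; lra.
  (* Dividing [B] by [1 - q], which lies between [0] and [1], enlarges it. *)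
  rewrite -{1}(Rmult_1_r B); apply: Rmult_le_compat_l => //.
  by rewrite -Rinv_1; apply: Rinv_le_contravar; lra.
apply: Rle_trans (pow_le_exp r c0) _.
suff le X : (INR r * c <= X -> exp (INR r * c) <= exp X)%R; last first.
  by case=> [/exp_increasing/Rlt_le|->] //; apply: Rle_refl.
apply: le.
have -> : (2 * INR r * S / S2 = z)%R by rewrite /z /q /Rdiv; ring.
(* Since [r * q = z / 2], the target exponent is exactly twice [r * c]. *)
have -> : ((2 * INR r * (S / S2)) ^ 2 * CL_pmax d / (1 - z) = 2 * (INR r * c))%R.
  by rewrite /c /y /z /q /CL_pmax -/S -/D /Rdiv; ring.
have : (0 <= INR r * c)%R by apply: Rmult_le_pos => //; lra.
lra.
Qed.
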